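(* Let $\mu \in \mathbb{R}$ and $\sigma > 0$ be fixed. As $r \to \infty$, the generalized lognormal distribution $\mathrm{GLN}(\mu,\sigma,r)$ tends (converges in distribution) to a probability distribution supported on a bounded interval. Hence this limiting distribution is M-det.
   Context: For $\mu \in \mathbb{R}$, $\sigma > 0$, $r > 0$, the generalized lognormal distribution $\mathrm{GLN}(\mu,\sigma,r)$ is the probability distribution on $(0,\infty)$ with density $$f(x) = \frac{1}{2\, x\, r^{1/r}\, \sigma\, \Gamma(1+1/r)} \exp\left\{ -\frac{1}{r\,\sigma^r} |\ln x - \mu|^r \right\}, \quad 0 < x < \infty.$$ A probability distribution $F$ with finite moments $m_k(F) = \int x^k \, dF(x)$ of all orders $k = 1,2,\dots$ is called moment-determinate (M-det) if it is uniquely determined by the sequence of these moments, i.e. any probability distribution $G$ on $\mathbb{R}$ with $m_k(G) = m_k(F)$ for all $k = 1,2,\dots$ equals $F$. *)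

(* Defs.v *)
From HB Require Import structures.
From mathcomp Require Import all_boot all_order all_algebra.
From mathcomp Require Import all_classical all_reals all_analysis.
From mathcomp Require Import measurable_realfun ring lra.

Set Implicit Arguments.
Unset Strict Implicit.
Unset Printing Implicit Defensive.

Import Order.TTheory GRing.Theory Num.Theory.
Import numFieldNormedType.Exports.

Local Open Scope classical_set_scope.
Local Open Scope ring_scope.

Definition Gamma (R : realType) (a : R) : R :=
  \int[lebesgue_measure]_(t in `]0, +oo[) (t `^ (a - 1) * expR (- t)).

(* As for the library's own distributions, parameters outside the meaningful
   range (here sigma <= 0 or r <= 0) are sent to a uniform density, so that
   gln_prob below is a probability measure for all parameters. *)
Definition gln_pdf (R : realType) (mu sigma r x : R) : R :=
  if (0 < sigma) && (0 < r) then
    if 0 < x then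
      (2 * x * r `^ r^-1 * sigma * Gamma (1 + r^-1))^-1 *
      expR (- (r * sigma `^ r)^-1 * `|ln x - mu| `^ r)
    else 0
  else \1_`[1, 2] x.

Definition gln_prob (R : realType) (mu sigma r : R)
    (V : set (measurableTypeR R)) : \bar R :=
  (\int[lebesgue_measure]_(x in V) (gln_pdf mu sigma r x)%:E)%E.

Lemma Gamma_ge0 (R : realType) (a : R) : 0 <= Gamma a.
Proof.
by apply: Rintegral_ge0 => t _; rewrite mulr_ge0 ?powR_ge0 ?expR_ge0.
Qed.

Lemma continuous_expRN (R : realType) (c : R) :
  continuous (fun t : R => expR (- (c * t))).
Proof.
move=> z; apply: continuous_comp; last exact: continuous_expR.
by apply: (@continuousN _ R^o); apply: continuousM => //; exact: cst_continuous.
Qed.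

Lemma measurable_expRN (R : realType) (c : R) (D : set R) :
  measurable_fun D (fun t : R => expR (- (c * t))).
Proof.
by apply: measurable_funTS; apply: continuous_measurable_fun; exact: continuous_expRN.
Qed.

Lemma integral_expRN (R : realType) (c s : R) : 0 < c ->
  (\int[lebesgue_measure]_(t in `]s, +oo[) (expR (- (c * t)))%:E
   = (c^-1 * expR (- (c * s)))%:E)%E.
Proof.
move=> c0.
have cE := @continuous_expRN R c.
rewrite integral_itv_obnd_cbnd; last first.
  by apply/measurable_EFinP; exact: measurable_expRN.
rewrite (@ge0_continuous_FTC2y _ _ (fun x => - (c^-1 * expR (- (c * x)))) _ 0)//.
- by rewrite EFinN oppeK add0e.
- exact: continuous_subspaceT.
- rewrite -oppr0; apply: cvgN; rewrite -(mulr0 c^-1); apply: cvgM; first exact: cvg_cst.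
  apply: (@cvg_comp _ _ _ (fun z => c * z) (fun z => expR (- z)) _
    (pinfty_nbhs R)); last exact: cvgr_expR.
  exact: gt0_cvgMry.
- apply: cvgN; apply: cvgM; first exact: cvg_cst.
  by apply/cvg_at_right_filter; exact: cE.
- move=> x _; rewrite derive1E.
  apply: derive_val => //; apply: is_derive_eq; rewrite /GRing.scale/=.
  by field; rewrite gt_eqF.
Qed.

Lemma integral_inv (R : realType) (a b : R) : 0 < a -> a < b ->
  (\int[lebesgue_measure]_(x in `]a, b[) (x^-1)%:E = (ln b - ln a)%:E)%E.
Proof.
move=> a0 ab.
have b0 : 0 < b by exact: lt_trans ab.
have cV x : a <= x -> {for x, continuous (fun x : R => x^-1)}.
  by move=> ax; apply: (@inv_continuous R); rewrite gt_eqF// (lt_le_trans a0).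
have cl x : a <= x -> {for x, continuous (@ln R)}.
  by move=> ax; apply: continuous_ln; rewrite (lt_le_trans a0).
rewrite -(@integral_itv_bndoo R a b _ true false); last first.
  apply/measurable_EFinP; apply: open_continuous_measurable_fun => // x.
  by rewrite inE/= in_itv/= => /andP[/ltW + _]; exact: cV.
rewrite (@continuous_FTC2 _ _ (@ln R))//.
- apply: continuous_in_subspaceT => x; rewrite inE/= in_itv/= => /andP[+ _].
  exact: cV.
- split.
  + move=> x; rewrite in_itv/= => /andP[ax _]; apply: ex_derive.
    by apply: is_derive1_ln; rewrite (lt_trans a0).
  + by apply/cvg_at_right_filter; exact: cl.
  + by apply/cvg_at_left_filter; apply: cl; exact: ltW.
- move=> x; rewrite in_itv/= => /andP[ax _]; rewrite derive1E.
  by apply: derive_val; apply: is_derive1_ln; rewrite (lt_trans a0).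
Qed.

Lemma Gamma_1D (R : realType) (p : R) : 0 < p ->
  0 < Gamma (1 + p) /\
  (\int[lebesgue_measure]_(t in `]0%R, +oo[) (t `^ p * expR (- t))%:E
   = (Gamma (1 + p))%:E)%E.
Proof.
move=> p0; rewrite /Gamma /Rintegral.
have -> : 1 + p - 1 = p by ring.
set I := (\int[_]_(t in _) _)%E.
have m1 D : measurable_fun D (fun t : R => t `^ p * expR (- t)).
  apply: measurable_funTS; apply: measurable_funM => //.
  exact: measurableT_comp.
have Ifin : (I < +oo)%E.
  pose C := expR (p * ln (2 * p)).
  apply: (@le_lt_trans _ _ (\int[lebesgue_measure]_(t in `]0%R, +oo[)
      (C%:E * (expR (- (2^-1 * t)))%:E))%E).
    apply: ge0_le_integral => //.
    - by move=> t _; rewrite lee_fin mulr_ge0 ?powR_ge0 ?expR_ge0.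
    - apply/measurable_EFinP; exact: m1.
    - apply: measurable_funeM; apply/measurable_EFinP.
      exact: measurable_expRN.
    - move=> t /=; rewrite in_itv/= andbT => t0.
      rewrite -EFinM lee_fin /powR gt_eqF// -!expRD ler_expR.
      have p20 : 0 < 2 * p by rewrite mulr_gt0.
      have : ln (t / (2 * p)) <= t / (2 * p) - 1.
        rewrite -[X in ln X](subrK 1) addrC; apply: le_ln1Dx.
        by rewrite ltrBrDl subrr divr_gt0.
      rewrite ln_div ?posrE// => h.
      have {h} : p * (ln t - ln (2 * p)) <= p * (t / (2 * p) - 1).
        by rewrite ler_pM2l.
      have -> : p * (t / (2 * p) - 1) = 2^-1 * t - p.
        by field; rewrite gt_eqF.
      by lra.
  rewrite ge0_integralZl_EFin ?expR_ge0//; last first.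
    by apply/measurable_EFinP; exact: measurable_expRN.
  by rewrite integral_expRN// -EFinM ltry.
have Igt : (0 < I)%E.
  apply: (@lt_le_trans _ _ (\int[lebesgue_measure]_(t in `[1%R, 2%R]) (expR (- 2))%:E)%E).
    rewrite integral_cst//= lebesgue_measure_itv/= lte_fin ltr1n -EFinB -EFinM.
    by rewrite lte_fin mulr_gt0 ?expR_gt0//; lra.
  apply: (@le_trans _ _ (\int[lebesgue_measure]_(t in `[1%R, 2%R])
      (t `^ p * expR (- t))%:E)%E).
    apply: ge0_le_integral => //.
    - apply/measurable_EFinP; exact: m1.
    - move=> t /=; rewrite in_itv/= => /andP[t1 t2]; rewrite lee_fin.
      rewrite -[leLHS]mul1r ler_pM ?expR_ge0// ?ler_expR ?lerN2//.
      by rewrite -[leLHS](@powRr0 _ t) ler_powR// ltW.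
  apply: ge0_subset_integral => //.
  - apply/measurable_EFinP; exact: m1.
  - by move=> t _; rewrite lee_fin mulr_ge0 ?powR_ge0 ?expR_ge0.
  - by move=> t /=; rewrite !in_itv/= andbT => /andP[t1 _]; rewrite (lt_le_trans _ t1).
split; first by rewrite fine_gt0// Igt Ifin.
by rewrite fineK// ge0_fin_numE// ltW.
Qed.

Lemma integral_gln_kernel (R : realType) (mu a r : R) : 0 < a -> 0 < r ->
  (\int[lebesgue_measure]_x
     (if 0 < x then x^-1 * expR (- (a * `|ln x - mu| `^ r)) else 0)%R%:E
   = (2 * a `^ (- r^-1) * Gamma (1 + r^-1))%:E)%E.
Proof.
move=> a0 r0; have rV0 : 0 < r^-1 by rewrite invr_gt0.
pose s (x : R) := a * `|ln x - mu| `^ r.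
have s_ge0 x : 0 <= s x by rewrite mulr_ge0 ?powR_ge0// ltW.
pose f (z : measurableTypeR R * measurableTypeR R) : R :=
  if [&& 0 < z.1, 0 < z.2 & s z.1 < z.2]
  then expR (- ln z.1) * expR (- z.2) else 0.
have f0 z : 0 <= f z by rewrite /f; case: ifP => // _; rewrite mulr_ge0 ?expR_ge0.
have ms : measurable_fun [set: R] s.
  apply: measurable_funM => //.
  apply: (measurableT_comp (measurable_powR r)).
  by apply: measurableT_comp => //; apply: measurable_funB.
have mf : measurable_fun setT f.
  apply: measurable_fun_ifT => //.
  - apply: measurable_and; first exact: measurable_fun_ltr.
    apply: measurable_and; first exact: measurable_fun_ltr.
    by apply: measurable_fun_ltr => //; exact: (measurableT_comp ms).
  - apply: measurable_funM.
      apply: measurableT_comp => //; apply: measurableT_comp => //.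
      exact: (measurableT_comp (@measurable_ln R)).
    by apply: measurableT_comp => //; apply: measurableT_comp.
have mf' : measurable_fun setT (EFin \o f) by exact/measurable_EFinP.
transitivity (\int[lebesgue_measure]_x \int[lebesgue_measure]_t
    (EFin \o f) (x, t))%E.
  apply: eq_integral => x _ /=; rewrite /f/=.
  case: ifPn => x0; last by rewrite integral0_eq.
  rewrite [RHS](_ : _ = \int[lebesgue_measure]_(t in `](s x), +oo[)
     ((x^-1)%:E * (expR (- (1 * t)))%:E))%E; last first.
    rewrite [RHS]integral_mkcond; apply: eq_integral => t _ /=.
    rewrite patchE mem_setE in_itv/= andbT.
    have [sxt|] := ltP (s x) t; last by rewrite andbF.
    by rewrite (le_lt_trans (s_ge0 x) sxt)/= mul1r expRN lnK.
  rewrite ge0_integralZl_EFin ?invr_ge0 ?(ltW x0)//; last first.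
    by apply/measurable_EFinP; exact: measurable_expRN.
  by rewrite integral_expRN// invr1 !mul1r -EFinM.
rewrite fubini_tonelli//.
transitivity (\int[lebesgue_measure]_(t in `]0%R, +oo[)
   ((2 * a `^ (- r^-1))%:E * (t `^ r^-1 * expR (- t))%:E))%E.
  rewrite [RHS]integral_mkcond; apply: eq_integral => t _ /=.
  rewrite patchE mem_setE in_itv/= andbT.
  case: ifPn => t0; last first.
    by apply: integral0_eq => x _; rewrite /f/= (negbTE t0) andbF.
  pose w := (t / a) `^ r^-1.
  have ta0 : 0 < t / a by rewrite divr_gt0.
  have w0 : 0 < w by rewrite powR_gt0.
  have wr : w `^ r = t / a by rewrite -powRrM mulVf ?gt_eqF// powRr1// ltW.
  transitivity (\int[lebesgue_measure]_(x in `](expR (mu - w)), (expR (mu + w))[)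
      ((expR (- t))%:E * (x^-1)%:E))%E.
    rewrite [RHS]integral_mkcond; apply: eq_integral => x _ /=.
    rewrite patchE mem_setE in_itv/= /f/= t0/=.
    have [x0|x0] := ltP 0 x; last first.
      have -> // : expR (mu - w) < x = false.
      by apply/negbTE; rewrite -leNgt (le_trans x0) ?expR_ge0.
    rewrite -[in RHS](@lnK _ x)// !ltr_expR lnK//.
    have -> : (s x < t) = (mu - w < ln x < mu + w).
      rewrite /s mulrC -ltr_pdivlMr// -wr.
      rewrite [RHS](_ : _ = (`|ln x - mu| < w)); last by rewrite ltr_distl.
      apply/idP/idP => [|h].
        by apply: contraTT; rewrite -!leNgt => h; rewrite ge0_ler_powR ?nnegrE// ltW.
      by rewrite gt0_ltr_powR// nnegrE// ltW.
    by case: (mu - w < ln x < mu + w) => //=; rewrite (expRN (ln x)) lnK// -EFinM mulrC.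
  have ww : expR (mu - w) < expR (mu + w) by rewrite ltr_expR; lra.
  rewrite ge0_integralZl_EFin ?expR_ge0//; last 2 first.
    move=> x; rewrite /= in_itv/= => /andP[x0 _]; rewrite lee_fin invr_ge0 ltW//.
    by rewrite (lt_trans _ x0)// expR_gt0.
    apply/measurable_EFinP; apply: open_continuous_measurable_fun => // x.
    rewrite inE/= in_itv/= => /andP[x0 _]; apply: (@inv_continuous R).
    by rewrite gt_eqF// (lt_trans _ x0)// expR_gt0.
  rewrite integral_inv ?expR_gt0// !expRK -!EFinM; congr EFin.
  have -> : w = t `^ r^-1 * a `^ (- r^-1).
    by rewrite /w powRM ?invr_ge0 ?ltW// -(@powR_inv1 _ a) ?ltW// -powRrM mulN1r.
  by ring.
rewrite ge0_integralZl_EFin//.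
- by rewrite (Gamma_1D rV0).2 -EFinM.
- by move=> t _; rewrite lee_fin mulr_ge0 ?powR_ge0 ?expR_ge0.
- apply/measurable_EFinP; apply: measurable_funTS; apply: measurable_funM => //.
  exact: measurableT_comp.
- by rewrite mulr_ge0 ?powR_ge0.
Qed.

Lemma gln_pdf_ge0 (R : realType) (mu sigma r x : R) : 0 <= gln_pdf mu sigma r x.
Proof.
rewrite /gln_pdf; case: ifP => [/andP[s0 r0]|_]; last by rewrite indicE.
case: ifP => // x0.
by rewrite mulr_ge0 ?expR_ge0// invr_ge0 !mulr_ge0 ?Gamma_ge0 ?powR_ge0 ?ltW.
Qed.

Lemma gln_pdfE (R : realType) (mu sigma r x : R) : 0 < sigma -> 0 < r ->
  gln_pdf mu sigma r x =
  (2 * r `^ r^-1 * sigma * Gamma (1 + r^-1))^-1 *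
  (if 0 < x then x^-1 * expR (- ((r * sigma `^ r)^-1 * `|ln x - mu| `^ r)) else 0).
Proof.
move=> s0 r0; rewrite /gln_pdf s0 r0/=.
case: ifPn => x0; last by rewrite mulr0.
rewrite mulNr mulrA; congr *%R.
by rewrite -invfM; congr (_^-1); ring.
Qed.

Lemma measurable_gln_kernel (R : realType) (mu a r : R) :
  measurable_fun [set: R] (fun x : R =>
    if 0 < x then x^-1 * expR (- (a * `|ln x - mu| `^ r)) else 0).
Proof.
rewrite [X in measurable_fun _ X](_ : _ = fun x => if 0 < x then
    expR (- ln x) * expR (- (a * `|ln x - mu| `^ r)) else 0); last first.
  by apply/funext => x; case: ifPn => // x0; rewrite (expRN (ln x)) lnK.
apply: measurable_fun_ifT => //; first exact: measurable_fun_ltr.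
apply: measurable_funM.
  by apply: measurableT_comp => //; exact: measurableT_comp.
apply: measurableT_comp => //; apply: measurableT_comp => //.
apply: measurable_funM => //; apply: (measurableT_comp (measurable_powR r)).
by apply: measurableT_comp => //; apply: measurable_funB.
Qed.

Lemma measurable_gln_pdf (R : realType) (mu sigma r : R) :
  measurable_fun [set: R] (gln_pdf mu sigma r).
Proof.
have [/andP[s0 r0]|sr] := boolP ((0 < sigma) && (0 < r)); last first.
  by rewrite /gln_pdf (negbTE sr); exact: measurable_indic.
rewrite (funext (fun x => gln_pdfE mu x s0 r0)).
by apply: measurable_funM => //; exact: measurable_gln_kernel.
Qed.

Lemma integral_gln_pdf (R : realType) (mu sigma r : R) :
  (\int[lebesgue_measure]_x (gln_pdf mu sigma r x)%:E = 1)%E.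
Proof.
have [/andP[s0 r0]|sr] := boolP ((0 < sigma) && (0 < r)); last first.
  rewrite /gln_pdf (negbTE sr) integral_indic//= setIT lebesgue_measure_itv/=.
  by rewrite lte_fin ltr1n -EFinB; congr EFin; ring.
have rV0 : 0 < r^-1 by rewrite invr_gt0.
under eq_integral do rewrite gln_pdfE// EFinM.
have G0 := (Gamma_1D rV0).1.
have rr0 : 0 < r `^ r^-1 by rewrite powR_gt0.
have sr0 : 0 < sigma `^ r by rewrite powR_gt0.
rewrite ge0_integralZl_EFin//; last 3 first.
- by move=> x _; case: ifP => // x0; rewrite lee_fin mulr_ge0 ?expR_ge0// invr_ge0 ltW.
- by apply/measurable_EFinP; exact: measurable_gln_kernel.
- by rewrite invr_ge0 !mulr_ge0// ltW.
rewrite integral_gln_kernel ?invr_gt0 ?mulr_gt0// -EFinM; congr EFin.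
have -> : (r * sigma `^ r)^-1 `^ (- r^-1) = r `^ r^-1 * sigma.
  rewrite -powR_inv1 ?mulr_ge0 ?ltW// -powRrM mulN1r opprK powRM ?ltW//.
  by rewrite -powRrM mulfV ?gt_eqF// powRr1// ltW.
by field; rewrite !gt_eqF.
Qed.

Lemma gln_prob0 (R : realType) (mu sigma r : R) : gln_prob mu sigma r set0 = 0%E.
Proof. by rewrite /gln_prob integral_set0. Qed.

Lemma gln_prob_ge0 (R : realType) (mu sigma r : R) V :
  (0 <= gln_prob mu sigma r V)%E.
Proof. by apply: integral_ge0 => x _; rewrite lee_fin gln_pdf_ge0. Qed.

Lemma gln_prob_sigma_additive (R : realType) (mu sigma r : R) :
  semi_sigma_additive (gln_prob mu sigma r).
Proof.
move=> A mA tA mUA; rewrite /gln_prob ge0_integral_bigcup//=; last 2 first.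
- by apply/measurable_EFinP/measurable_funTS; exact: measurable_gln_pdf.
- by move=> x _; rewrite lee_fin gln_pdf_ge0.
apply: is_cvg_ereal_nneg_natsum_cond => n _ _.
by apply: integral_ge0 => x _; rewrite lee_fin gln_pdf_ge0.
Qed.

HB.instance Definition _ (R : realType) (mu sigma r : R) :=
  isMeasure.Build _ _ _ (gln_prob mu sigma r) (gln_prob0 mu sigma r)
    (gln_prob_ge0 mu sigma r) (@gln_prob_sigma_additive R mu sigma r).

Lemma gln_probT (R : realType) (mu sigma r : R) :
  gln_prob mu sigma r [set: _] = 1%E.
Proof. exact: integral_gln_pdf. Qed.

HB.instance Definition _ (R : realType) (mu sigma r : R) :=
  @Measure_isProbability.Build _ _ R (gln_prob mu sigma r) (gln_probT mu sigma r).

Definition cvg_in_distribution (R : realType) (I : Type)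
    (P : I -> probability (measurableTypeR R) R) (F : set_system I)
    (Q : probability (measurableTypeR R) R) : Prop :=
  forall h : R -> R, continuous h -> (exists M, forall x, `|h x| <= M) ->
    ('E_(P i)[h])%E @[i --> F] --> ('E_Q[h])%E.

Definition moment (R : realType) (P : probability (measurableTypeR R) R)
    (k : nat) : \bar R :=
  'E_P[fun x : R => (x ^+ k)%R]%E.

Definition finite_moments (R : realType)
    (P : probability (measurableTypeR R) R) : Prop :=
  forall k : nat, (0 < k)%N ->
    P.-integrable [set: R] (fun x : R => (x ^+ k)%:E).

(* Q is not assumed to have finite moments: in \bar R an ill-defined integral
   (+oo - +oo) evaluates to -oo, so equality with the finite moments of P already
   forces the moments of Q to exist and to be finite. *)
Definition moment_determinate (R : realType)
    (P : probability (measurableTypeR R) R) : Prop :=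
  finite_moments P /\
  forall Q : probability (measurableTypeR R) R,
    (forall k : nat, (0 < k)%N -> moment Q k = moment P k) ->
    forall A : set (measurableTypeR R), measurable A -> Q A = P A.

(* Main.v *)
(* Write [u = |ln x - mu| / sigma].  Up to normalization the density of GLN is
   [x^-1 * exp(- u ^ r / r)], which tends pointwise to [x^-1] if [u <= 1] and to 0
   if [u > 1], and is dominated by an integrable function because
   [u - 1 <= u ^ r / r] for [r >= 1].  Dominated convergence gives the limits of the
   unnormalized integrals of bounded test functions; the test function 1 gives the
   limit of the normalizing constants, so no asymptotics of Gamma are needed.  The
   limit is the law with density [1 / (2 sigma x)] on
   [[exp(mu - sigma), exp(mu + sigma)]].

   Moment-determinacy: if Q has the moments of a law living on [[-K, K]], Markov's
   inequality for the powers [x ^ (2k)] shows that Q does not charge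
   [|x| >= K + 1].  Explicit polynomials, bounded on a compact interval, converge
   pointwise to the indicator of [x < c], so both laws give the same mass to
   every [x < c]. *)

From HB Require Import structures.
Require Import Defs.
From mathcomp Require Import all_boot all_order all_algebra.
From mathcomp Require Import all_classical all_reals all_analysis.
From mathcomp Require Import measurable_realfun ring lra.

Set Implicit Arguments.
Unset Strict Implicit.
Unset Printing Implicit Defensive.

Import Order.TTheory GRing.Theory Num.Theory.
Import numFieldNormedType.Exports.

Local Open Scope classical_set_scope.
Local Open Scope ring_scope.

(** * Moment-determinacy of compactly supported laws *)

Lemma bernoulli_le (R : realDomainType) (a : R) (m : nat) : 0 <= a <= 1 ->
  1 - m%:R * a <= (1 - a) ^+ m.
Proof.
move=> /andP[a0 a1]; elim: m => [|m ih]; first by rewrite mul0r subr0.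
rewrite exprS; apply: (@le_trans _ _ ((1 - a) * (1 - m%:R * a))); last first.
  by rewrite ler_wpM2l// subr_ge0.
have -> : (1 - a) * (1 - m%:R * a) = 1 - m.+1%:R * a + m%:R * a ^+ 2
  by rewrite -natr1; ring.
by rewrite lerDl mulr_ge0// sqr_ge0.
Qed.

(** Since [(1 - a) * (1 + m.+1 * a) <= 1 + m * a], the left side is nonincreasing in [m]. This bound
    forces the step polynomials to 0 on the positive side, while [bernoulli_le] forces them to 1 on
    the negative side. *)
Lemma bernoulli_ge (R : realDomainType) (a : R) (m : nat) : 0 <= a <= 1 ->
  (1 - a) ^+ m * (1 + m%:R * a) <= 1.
Proof.
move=> /andP[a0 a1]; elim: m => [|m ih]; first by rewrite mul0r addr0 mulr1.
apply: le_trans ih; rewrite exprSr -mulrA ler_wpM2l ?exprn_ge0 ?subr_ge0//.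
have -> : (1 - a) * (1 + m.+1%:R * a) = 1 + m%:R * a - m.+1%:R * a ^+ 2
  by rewrite -natr1; ring.
by rewrite gerBl mulr_ge0// sqr_ge0.
Qed.

(* With [y = (1 + z) / 2], [(1 - y ^ n) ^ (2 ^ n)] tends to 1 for [0 <= y < 1/2] and
   to 0 for [1/2 < y <= 1], but to [1/e] at [y = 1/2], i.e. at [z = 0]; the second
   factor makes the value there 0 and tends to 1 elsewhere. *)
Definition step_poly (R : realType) (n : nat) : {poly R} :=
  (1 - (2^-1 *: (1 + 'X)) ^+ n) ^+ (2 ^ n) * (1 - (1 - 'X^2) ^+ n).

Lemma horner_step_poly (R : realType) n (z : R) : (step_poly R n).[z] =
  (1 - ((1 + z) / 2) ^+ n) ^+ (2 ^ n) * (1 - (1 - z ^+ 2) ^+ n).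
Proof.
rewrite /step_poly !(hornerE, horner_exp) ; congr ((1 - _ ^+ _) ^+ _ * _).
by rewrite mulrC.
Qed.

Lemma step_poly_itv01 (R : realType) n (z : R) : `|z| <= 1 ->
  0 <= (step_poly R n).[z] <= 1.
Proof.
rewrite ler_norml horner_step_poly => /andP[z1 z2].
have y01 : 0 <= ((1 + z) / 2) ^+ n <= 1.
  by rewrite exprn_ge0 ?exprn_ile1//; lra.
have z01 : 0 <= (1 - z ^+ 2) ^+ n <= 1.
  have z21 : z ^+ 2 <= 1 by rewrite -real_normK ?num_real// exprn_ile1// ler_norml z1.
  by rewrite exprn_ge0 ?exprn_ile1 ?subr_ge0// gerBl sqr_ge0.
move: y01 z01; set y := _ ^+ n; set w := _ ^+ n => /andP[y0 y1] /andP[w0 w1].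
rewrite mulr_ge0 ?exprn_ge0 ?subr_ge0//= mulr_ile1 ?exprn_ge0 ?exprn_ile1 ?subr_ge0
  ?gerBl//.
Qed.

Lemma cvg_step_poly (R : realType) (z : R) : `|z| <= 1 ->
  (step_poly R n).[z] @[n --> \oo] --> ((z < 0)%R%:R : R).
Proof.
rewrite ler_norml => /andP[z1 z2].
under eq_fun do rewrite horner_step_poly.
have [->|z0] := eqVneq z 0.
  rewrite ltxx expr0n/= subr0.
  by under eq_fun do rewrite expr1n subrr mulr0; exact: cvg_cst.
rewrite -[_%:R]mulr1; apply: cvgM; last first.
  have z21 : z ^+ 2 <= 1 by rewrite -real_normK ?num_real// exprn_ile1// ler_norml z1.
  have /cvg_expr : `|1 - z ^+ 2| < 1.
    by rewrite ger0_norm ?subr_ge0// gtrBl exprn_even_gt0.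
  by move=> /(cvgB (cvg_cst (1 : R^o))); rewrite subr0; apply.
have y01 n : 0 <= ((1 + z) / 2) ^+ n <= 1.
  by rewrite exprn_ge0 ?exprn_ile1//; lra.
(* The outer exponent [2 ^ n] turns both Bernoulli bounds into bounds by powers of [1 + z], a ratio
   below 1 for [z < 0] and above 1 for [z > 0]. *)
have yE n : (2 ^ n)%:R * ((1 + z) / 2) ^+ n = (1 + z) ^+ n.
  by rewrite natrX -exprMn; congr (_ ^+ _); field.
move: z0; rewrite neq_lt => /orP[z0|z0].
  rewrite z0; apply: (@squeeze_cvgr _ _ _ _ (fun n => 1 - (1 + z) ^+ n) (fun=> 1)).
  - apply: nearW => n; rewrite -yE bernoulli_le//= exprn_ile1//.
    + by rewrite subr_ge0; case/andP: (y01 n).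
    + by rewrite gerBl; case/andP: (y01 n).
  - have /cvg_expr : `|1 + z| < 1 by rewrite ltr_norml; apply/andP; split; lra.
    by move=> /(cvgB (cvg_cst (1 : R^o))); rewrite subr0; apply.
  - exact: cvg_cst.
rewrite ltNge (ltW z0)/=.
have z10 : 0 < 1 + z by lra.
apply: (@squeeze_cvgr _ _ _ _ (fun=> 0) (fun n => ((1 + z)^-1) ^+ n)).
- apply: nearW => n; have /andP[y0 y1] := y01 n.
  rewrite exprn_ge0 ?subr_ge0//= exprVn -[X in _ <= X]mul1r ler_pdivlMr ?exprn_gt0//.
  apply: le_trans (bernoulli_ge (2 ^ n) (y01 n)).
  by rewrite ler_wpM2l ?exprn_ge0 ?subr_ge0// yE lerDr.
- exact: cvg_cst.
- by apply: cvg_expr; rewrite ger0_norm ?invr_ge0 ?(ltW z10)// invf_lt1//; lra.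
Qed.

(** * Integrals of polynomials under laws with equal moments *)

Lemma integrable_exprn (R : realType) (P : probability (measurableTypeR R) R) k :
  finite_moments P -> P.-integrable [set: R] (fun x : R => (x ^+ k)%:E).
Proof.
move=> mP; case: k => [|k]; last exact: mP.
by under eq_fun do rewrite expr0; exact: finite_measure_integrable_cst.
Qed.

Lemma integrable_horner (R : realType) (P : probability (measurableTypeR R) R)
    (p : {poly R}) : finite_moments P ->
  P.-integrable [set: R] (fun x : R => p.[x]%:E).
Proof.
move=> mP; under eq_fun do rewrite horner_coef -sumEFin.
apply: integrable_sum => // i _; under eq_fun do rewrite EFinM.
by apply: integrableZl => //; exact: integrable_exprn.
Qed.

Lemma integral_horner_eq (R : realType) (P Q : probability (measurableTypeR R) R)
    (p : {poly R}) : finite_moments P -> finite_moments Q ->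
  (forall k, (0 < k)%N -> moment Q k = moment P k) ->
  (\int[Q]_x p.[x]%:E = \int[P]_x p.[x]%:E)%E.
Proof.
move=> mP mQ PQ.
have hE (N : probability (measurableTypeR R) R) : finite_moments N ->
    (\int[N]_x p.[x]%:E = \sum_(i < size p) (p`_i)%:E * moment N i)%E.
  move=> mN; under eq_integral do rewrite horner_coef -sumEFin.
  rewrite integral_sum//=; last first.
    move=> i; under eq_fun do rewrite EFinM.
    by apply: integrableZl => //; exact: integrable_exprn.
  apply: eq_bigr => i _; under eq_integral do rewrite EFinM.
  by rewrite /moment [in RHS]unlock integralZl//; exact: integrable_exprn.
rewrite !hE//; apply: eq_bigr => -[[|i] /= ip] _; last by rewrite PQ.
(* The hypothesis on moments starts at order 1; in order 0 both laws have total mass 1. *)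
have h0 (N : probability (measurableTypeR R) R) : moment N 0 = 1%E.
  by rewrite /moment -(@expectation_cst _ _ _ N 1); congr expectation.
by rewrite !h0.
Qed.

(** The map [x |-> (x - c) / L] sends almost every point into [-1, 1], where the step polynomials
    take values in [0, 1]. The constant 1 therefore dominates them, and their limit is the indicator
    of [x < c]. *)
Lemma integral_step_poly_cvg (R : realType) (P : probability (measurableTypeR R) R)
    (T c : R) : P [set x | T <= `|x|] = 0%E ->
  (\int[P]_x ((step_poly R n) \Po ((`|T| + `|c| + 1)^-1 *: ('X - c%:P))).[x]%:E
    @[n --> \oo] --> P `]-oo, c[%classic)%E.
Proof.
move=> PT; set L := `|T| + `|c| + 1.
(* The summand 1 keeps [L] positive even when [T = c = 0]. *)
have L0 : 0 < L by rewrite ltr_wpDl// addr_ge0.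
have aeP : {ae P, forall x, `|L^-1 * (x - c)| <= 1}.
  exists [set x | T <= `|x|]; split => //=.
    rewrite (_ : [set _ | _] = (fun x : R => `|x|) @^-1` `[T, +oo[%classic).
      by rewrite -[X in measurable X]setTI; exact: normr_measurable.
    by apply/seteqP; split => x /=; rewrite in_itv/= andbT.
  move=> x /= h; rewrite leNgt; apply/negP => xT; apply: h.
  rewrite normrM ger0_norm ?invr_ge0 ?(ltW L0)// mulrC ler_pdivrMr// mul1r.
  rewrite (le_trans (ler_normB _ _))// /L -addrA lerD ?lerDl//.
  by rewrite (le_trans (ltW xT))// ler_norm.
have hE n x : ((step_poly R n) \Po (L^-1 *: ('X - c%:P))).[x] =
    (step_poly R n).[L^-1 * (x - c)].
  by rewrite horner_comp !hornerE.
rewrite (_ : P _ = \int[P]_x ((x < c)%R%:R)%:E)%E; last first.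
  transitivity (\int[P]_x (\1_(`]-oo, c[%classic) x)%:E)%E.
    by rewrite integral_indic// setIT.
  by apply: eq_integral => x _; rewrite indicE mem_setE in_itv.
have mp (p : {poly R}) : measurable_fun [set: measurableTypeR R]
    (fun x : R => p.[x]%:E).
  apply/measurable_EFinP; apply: continuous_measurable_fun.
  exact: continuous_horner.
have [|||||] := @dominated_convergence _ (measurableTypeR R) R P setT measurableT
  (fun n x => ((step_poly R n) \Po (L^-1 *: ('X - c%:P))).[x]%:E)
  (fun x => ((x < c)%R%:R)%:E) (cst 1%E).
- by move=> n; exact: mp.
- rewrite (_ : (fun _ => _) = EFin \o \1_(`]-oo, c[%classic)).
    exact/measurable_EFinP/measurable_indic.
  by apply/funext => x; rewrite /= indicE mem_setE in_itv.
- apply: (@filterS _ _ (ae_filter_ringOfSetsType P) _ _ _ aeP) => x h _;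
    apply: cvg_EFin; first exact: nearW.
  under eq_fun do rewrite /= hE.
  have -> : (x < c) = (L^-1 * (x - c) < 0) by rewrite pmulr_rlt0 ?invr_gt0// subr_lt0.
  exact: cvg_step_poly.
- exact: finite_measure_integrable_cst.
- apply: (@filterS _ _ (ae_filter_ringOfSetsType P) _ _ _ aeP) => x h n _;
    rewrite hE/= lee_fin.
  by have /andP[h0 h1] := step_poly_itv01 n h; rewrite ger0_norm.
- by [].
Qed.

(** * Control of a law by its even moments *)

Lemma norm_ge_null (R : realType) (Q : probability (measurableTypeR R) R)
    (K T : R) : 0 <= K < T ->
  (forall k, (0 < k)%N -> moment Q (k.*2) <= (K ^+ k.*2)%:E)%E ->
  Q [set x | T <= `|x|] = 0%E.
Proof.
move=> /andP[K0 KT] mQ.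
have T0 : 0 < T by exact: le_lt_trans KT.
have mk k : (0 < k)%N -> (Q [set x | (T <= `|x|)%R] <= ((K / T) ^+ k.*2)%:E)%E.
  move=> k0; rewrite expr_div_n mulrC EFinM lee_pdivlMl ?exprn_gt0//.
  apply: le_trans (mQ _ k0).
  (* Markov's inequality for [x ^ (2k)] at level [T ^ (2k)] bounds the tail by [(K / T) ^ (2k)],
     which vanishes as [k] grows. *)
  have := @le_integral_abse _ _ _ Q _ measurableT (fun x : R => (x ^+ k.*2)%:E)
    (T ^+ k.*2).
  rewrite exprn_gt0// => /(_ _ isT).
  rewrite (_ : _ `&` _ = [set x | T <= `|x|]); last first.
    apply/seteqP; split => x /=; rewrite ?lee_fin normrX.
      by case=> _; rewrite ler_pXn2r ?nnegrE// ?(ltW T0)// double_gt0.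
    by move=> Tx; split => //; rewrite lerXn2r// nnegrE ltW.
  move=> h; apply: le_trans (h _) _;
    first by apply/measurable_EFinP; exact: exprn_measurable.
  rewrite /moment unlock le_eqVlt; apply/orP; left; apply/eqP/eq_integral => x _.
  by rewrite /= ger0_norm// exprn_even_ge0// odd_double.
have h0 : ((K / T) ^+ 2) ^+ k @[k --> \oo] --> (0 : R).
  apply: cvg_expr; rewrite ger0_norm ?sqr_ge0// expr_lt1// ?divr_ge0 ?(ltW T0)//.
  by rewrite ltr_pdivrMr// mul1r.
have {}h0 : (((K / T) ^+ 2) ^+ k)%:E @[k --> \oo] --> 0%E
  by apply: cvg_EFin; [exact: nearW|exact: h0].
apply/eqP; rewrite eq_le measure_ge0 andbT.
rewrite -(cvg_lim _ h0)//; apply: lime_ge; first exact: cvgP h0.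
near=> k; rewrite -exprM mul2n; apply: mk.
by near: k; exact: nbhs_infty_gt.
Unshelve. all: by end_near. Qed.

(** Even powers are nonnegative, so a finite even moment is genuine integrability, and
    [|x ^ k| <= 1 + x ^ (2k)] then handles every order. This is how integrability is obtained for a
    competitor law known only through its moments. *)
Lemma even_moments_finite (R : realType) (Q : probability (measurableTypeR R) R) :
  (forall k, (0 < k)%N -> moment Q (k.*2) < +oo)%E -> finite_moments Q.
Proof.
move=> mQ k k0; apply: (@le_integrable _ (measurableTypeR R) R Q _ measurableT _
  (fun x : R => 1%:E + (x ^+ k.*2)%:E)%E).
- by apply/measurable_EFinP; exact: exprn_measurable.
- move=> x _; rewrite -EFinD lee_fin.
  have -> : x ^+ k.*2 = `|x ^+ k| ^+ 2 by rewrite real_normK ?num_real// -exprM muln2.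
  by rewrite [leRHS]ger0_norm ?addr_ge0 ?sqr_ge0//; nra.
- apply: integrableD => //; first exact: finite_measure_integrable_cst.
  apply/integrableP; split; first by apply/measurable_EFinP; exact: exprn_measurable.
  apply: le_lt_trans (mQ k k0); rewrite /moment unlock le_eqVlt; apply/orP; left.
  apply/eqP/eq_integral => x _.
  by rewrite /= ger0_norm// exprn_even_ge0// odd_double.
Qed.

Lemma bounded_support_moment_determinate (R : realType)
    (P : probability (measurableTypeR R) R) (a b : R) :
  P `[a, b]%classic = 1%E -> moment_determinate P.
Proof.
move=> Pab; pose K := Num.max `|a| `|b|.
have K0 : 0 <= K by rewrite le_max normr_ge0.
have aeK : {ae P, forall x, `|x| <= K}.
  exists (~` `[a, b]%classic); split.
  - exact: measurableC.
  - by rewrite [LHS]probability_setC// Pab subee.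
  - move=> x /= h; rewrite in_itv/= => /andP[ax xb]; apply: h.
    rewrite ler_norml /K; apply/andP; split.
      by rewrite lerNl le_max -(normrN a) (le_trans _ (ler_norm (- a))) ?lerN2.
    by rewrite le_max (le_trans xb (ler_norm _)) orbT.
have mP k : (moment P k.*2 <= (K ^+ k.*2)%:E)%E.
  rewrite /moment unlock (_ : (K ^+ _)%:E = \int[P]_x (K ^+ k.*2)%:E)%E; last first.
    by rewrite integral_cst// -[LHS]mule1; congr (_ * _)%E;
      exact/esym/(probability_setT P).
  apply: ae_ge0_le_integral => //.
  - by move=> x _; rewrite lee_fin exprn_even_ge0 ?odd_double.
  - by apply/measurable_EFinP; exact: exprn_measurable.
  - by move=> x _; rewrite lee_fin exprn_ge0.
  - apply: (@filterS _ _ (ae_filter_ringOfSetsType P) _ _ _ aeK) => x xK _;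
      rewrite lee_fin.
    rewrite -[x ^+ _]ger0_norm ?exprn_even_ge0 ?odd_double// normrX.
    by rewrite lerXn2r// nnegrE.
(* The tail lemma needs a level strictly above [K], including when [K = 0]. *)
have K1 : 0 <= K < K + 1 by rewrite K0 ltrDl ltr01.
have fP : finite_moments P.
  by apply: even_moments_finite => k _; rewrite (le_lt_trans (mP k))// ltry.
split => // Q QP.
(* Equality of moments transfers the bound from [P] to [Q]; it yields both the integrability of
   powers under [Q] and the vanishing of its tail. *)
have mQ k : (0 < k)%N -> (moment Q k.*2 <= (K ^+ k.*2)%:E)%E.
  by move=> k0; rewrite QP ?mP// double_gt0.
have fQ : finite_moments Q.
  by apply: even_moments_finite => k k0; rewrite (le_lt_trans (mQ k k0))// ltry.
have PK := norm_ge_null K1 (fun k _ => mP k).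
have QK := norm_ge_null K1 mQ.
move=> A mA.
(* Open left rays are stable under intersection, generate the Borel sets and exhaust the line, so
   agreement on them suffices. *)
apply: (@measure_unique _ R (measurableTypeR R) (@RGenInftyO.G R)
  (fun n => `]-oo, n%:R[%classic)) => //.
- exact: RGenInftyO.measurableE.
- move=> _ _ [x ->] [y ->]; exists (Num.min x y).
  by apply/seteqP; split => z /=; rewrite !in_itv/= lt_min => /andP.
- by move=> n; exists n%:R.
- rewrite -subTset => x _; exists (Num.bound `|x|) => //=.
  by rewrite in_itv/= (le_lt_trans (ler_norm x))// archi_boundP.
- move=> _ [c ->].
  (* The masses of the ray under [Q] and under [P] are limits of one and the same sequence of
     polynomial integrals. *)
  have := @integral_step_poly_cvg R Q _ c QK.
  under eq_fun do rewrite (integral_horner_eq _ fP fQ QP).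
  by move/cvg_unique; apply => //; exact: integral_step_poly_cvg.
- by move=> n; rewrite (le_lt_trans (probability_le1 _ _))// ltry.
Qed.

(** * Probability measures given by a density *)

Section density.
Context d (T : measurableType d) (R : realType).
Variables (la : {measure set T -> \bar R}) (f : T -> R).

(** The proofs are arguments so that the probability structure can be inferred from the term
    itself. *)
Definition density_prob of measurable_fun [set: T] f & (forall x, 0 <= f x) &
  (\int[la]_x (f x)%:E = 1)%E := fun A : set T => (\int[la]_(x in A) (f x)%:E)%E.

Hypotheses (mf : measurable_fun [set: T] f) (f_ge0 : forall x, 0 <= f x).
Hypothesis int_f : (\int[la]_x (f x)%:E = 1)%E.
Let P := density_prob mf f_ge0 int_f.

Let P0 : P set0 = 0%E.
Proof. exact: integral_set0. Qed.

Let P_ge0 A : (0 <= P A)%E.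
Proof. by apply: integral_ge0 => x _; rewrite lee_fin. Qed.

Let P_sigma_additive : semi_sigma_additive P.
Proof.
move=> A mA tA mUA; rewrite /P /density_prob ge0_integral_bigcup//=; last 2 first.
- exact/measurable_EFinP/measurable_funTS.
- by move=> x _; rewrite lee_fin.
apply: is_cvg_ereal_nneg_natsum_cond => n _ _.
by apply: integral_ge0 => x _; rewrite lee_fin.
Qed.

HB.instance Definition _ :=
  isMeasure.Build _ _ _ P P0 P_ge0 P_sigma_additive.

HB.instance Definition _ := @Measure_isProbability.Build _ _ R P int_f.

End density.

(** Here [nu] is absolutely continuous with respect to [la], and its Radon-Nikodym derivative equals
    [f] almost everywhere because both have the same integral over every measurable set. *)
Lemma integral_density d (T : measurableType d) (R : realType)
    (la : {sigma_finite_measure set T -> \bar R}) (f : T -> R)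
    (nu : {finite_measure set T -> \bar R}) (h : T -> \bar R) :
  measurable_fun [set: T] f -> (forall x, 0 <= f x) ->
  (forall A, measurable A -> nu A = (\int[la]_(x in A) (f x)%:E)%E) ->
  nu.-integrable [set: T] h ->
  (\int[nu]_x h x = \int[la]_x (h x * (f x)%:E))%E.
Proof.
move=> mf f0 nuE ih.
have nula : nu `<< la.
  apply/null_content_dominatesP => A mA A0.
  by rewrite nuE//; apply: null_set_integral => //;
    exact/measurable_EFinP/measurable_funTS.
have if_ : la.-integrable [set: T] (EFin \o f).
  apply/integrableP; split; first exact/measurable_EFinP.
  under eq_integral do rewrite /= ger0_norm//.
  by rewrite -nuE// -ge0_fin_numE// fin_num_measure.
have iRN := @Radon_Nikodym_integrable _ _ _ (charge_of_finite_measure nu) la nula.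
rewrite -(Radon_Nikodym_change_of_variables nula)//.
apply: ae_eq_integral => //.
- apply: emeasurable_funM; first exact: measurable_int _ ih.
  exact: measurable_int _ iRN.
- by apply: emeasurable_funM; [exact: measurable_int _ ih|exact/measurable_EFinP].
- apply: ae_eqe_mul2l; apply: integral_ae_eq => //.
  + exact/measurable_EFinP.
  + by move=> A _ mA; rewrite -Radon_Nikodym_integral// -nuE.
Qed.

Lemma measurable_bounded_expectation_density (R : realType) (f h : R -> R) (M : R)
    (P : probability (measurableTypeR R) R) :
  measurable_fun [set: R] f -> (forall x, 0 <= f x) ->
  (forall A : set (measurableTypeR R), measurable A ->
    P A = \int[lebesgue_measure]_(x in A) (f x)%:E)%E ->
  measurable_fun [set: R] h -> (forall x, `|h x| <= M) ->
  'E_P[h]%E = (\int[lebesgue_measure]_x (h x * f x)%:E)%E.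
Proof.
move=> mf f0 PE mh hM; rewrite unlock.
have ih : P.-integrable [set: measurableTypeR R] (EFin \o h).
  apply: measurable_bounded_integrable => //.
    by rewrite (le_lt_trans (probability_le1 P _))// ltry.
  exists M; split; first exact: num_real.
  by move=> x Mx y _; exact: le_trans (hM y) (ltW Mx).
by rewrite (@integral_density _ (measurableTypeR R) R lebesgue_measure f P).
Qed.

(** * Convergence of the kernels *)

(** Young's inequality for the product [u * 1] gives [u <= u ^ r / r + (1 - 1 / r)]. The case
    [r = 1] is separate because the conjugate exponent would be infinite. *)
Lemma subr1_le_powR_div (R : realType) (u r : R) : 0 <= u -> 1 <= r ->
  u - 1 <= u `^ r / r.
Proof.
move=> u0; rewrite le_eqVlt => /predU1P[<-|r1].
  by rewrite powRr1// divr1 lerBlDr lerDl.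
have r0 : 0 < r by exact: lt_trans r1.
have r1V : 0 < 1 - r^-1 by rewrite subr_gt0 invf_lt1.
have := @conjugate_powR R u 1 r (1 - r^-1)^-1 u0 ler01 r0.
rewrite invr_gt0 => /(_ r1V); rewrite invrK addrC subrK => /(_ erefl).
rewrite mulr1 powR1 mul1r => /le_trans h.
by rewrite lerBlDr; apply: h; rewrite lerD2l gerBl invr_ge0 ltW.
Qed.

Lemma cvg_expRN_powR_div (R : realType) (u : R) : 0 <= u ->
  expR (- (u `^ r / r)) @[r --> +oo] --> ((u <= 1)%R%:R : R).
Proof.
move=> u0; have [u1|u1] := leP u 1.
  apply: (@squeeze_cvgr _ _ _ _ (fun r : R => expR (- r^-1)) (fun=> 1)).
  - near=> r; have r0 : 0 < r by near: r; exact: nbhs_pinfty_gt.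
    apply/andP; split; last by rewrite -expR0 ler_expR oppr_le0 divr_ge0 ?powR_ge0 ?ltW.
    rewrite ler_expR lerN2 -[leRHS]mul1r ler_pM2r ?invr_gt0//.
    have <- : 1 `^ r = 1 :> R by rewrite powR1.
    by rewrite ge0_ler_powR ?nnegrE// ltW.
  - rewrite -(@expR0 R); apply: continuous_cvg; first exact: continuous_expR.
    rewrite -oppr0; apply: cvgN; apply/gtr0_cvgV0; last exact: cvg_id.
    by near=> r; near: r; exact: nbhs_pinfty_gt.
  - exact: cvg_cst.
(* The bound [u - 1 <= u ^ r / r] does not diverge with [r]. Applied to [v] and squared, it does: [u
   ^ r / r = (v ^ r / r) ^ 2 * r >= (v - 1) ^ 2 * r]. *)
pose v := Num.sqrt u.
have v1 : 1 < v by rewrite -(@sqrtr1 R) ltr_sqrt// (lt_trans _ u1).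
apply: (@squeeze_cvgr _ _ _ _ (fun=> 0) (fun r : R => expR (- ((v - 1) ^+ 2 * r)))).
- near=> r; have r0 : 0 < r by near: r; exact: nbhs_pinfty_gt.
  have r1 : 1 <= r by near: r; exact: nbhs_pinfty_ge.
  rewrite expR_ge0/= ler_expR lerN2.
  have v0 : 0 <= v by exact: sqrtr_ge0.
  have h := subr1_le_powR_div v0 r1.
  have -> : u `^ r / r = (v `^ r / r) ^+ 2 * r.
    have -> : u `^ r = (v `^ r) ^+ 2.
      by rewrite -{1}(sqr_sqrtr u0) expr2 powRM// expr2.
    by field; rewrite gt_eqF.
  by rewrite ler_pM2r// lerXn2r// nnegrE ?subr_ge0 ?(ltW v1)// divr_ge0 ?powR_ge0// ltW.
- exact: cvg_cst.
- apply: (@cvg_comp _ _ _ (fun r => (v - 1) ^+ 2 * r) (fun z => expR (- z)) _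
    (pinfty_nbhs R)); last exact: cvgr_expR.
  by apply: gt0_cvgMry; rewrite ?exprn_gt0 ?subr_gt0//; exact: cvg_id.
Unshelve. all: by end_near. Qed.

Definition gln_kernel (R : realType) (mu sigma r x : R) : R :=
  if 0 < x then x^-1 * expR (- ((r * sigma `^ r)^-1 * `|ln x - mu| `^ r)) else 0.

Definition inv_kernel (R : realType) (a b x : R) : R :=
  if a <= x <= b then x^-1 else 0.

Section kernels.
Context (R : realType) (mu sigma : R).
Hypothesis sigma_gt0 : 0 < sigma.
Let a := expR (mu - sigma).
Let b := expR (mu + sigma).

Lemma gln_kernelE r x : 0 < r -> 0 < x ->
  gln_kernel mu sigma r x = x^-1 * expR (- ((`|ln x - mu| / sigma) `^ r / r)).
Proof.
move=> r0 x0; rewrite /gln_kernel x0; congr (_ * expR (- _)).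
rewrite powRM ?invr_ge0 ?(ltW sigma_gt0)// -(powR_inv1 (ltW sigma_gt0)) -powRrM mulN1r.
by rewrite powRN invfM mulrC -mulrA; congr *%R; rewrite mulrC.
Qed.

Lemma gln_kernel_ge0 r x : 0 <= gln_kernel mu sigma r x.
Proof.
by rewrite /gln_kernel; case: ifP => // x0; rewrite mulr_ge0 ?expR_ge0// invr_ge0 ltW.
Qed.

Lemma inv_kernel_ge0 x : 0 <= inv_kernel a b x.
Proof.
rewrite /inv_kernel; case: ifP => // /andP[ax _]; rewrite invr_ge0.
by rewrite (le_trans _ ax)// expR_ge0.
Qed.

Lemma measurable_inv_kernel : measurable_fun [set: R] (inv_kernel a b).
Proof.
rewrite (_ : inv_kernel a b = fun x => if a <= x <= b then expR (- ln x) else 0).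
  apply: measurable_fun_ifT => //.
    by apply: measurable_and; apply: measurable_fun_ler.
  by apply: measurableT_comp => //; apply: measurableT_comp.
apply/funext => x; rewrite /inv_kernel; case: ifP => // /andP[ax _].
by rewrite expRN lnK// posrE (lt_le_trans _ ax)// expR_gt0.
Qed.

Lemma integral_inv_kernel :
  (\int[lebesgue_measure]_x (inv_kernel a b x)%:E = (2 * sigma)%:E)%E.
Proof.
have ab : a < b by rewrite ltr_expR; move: sigma_gt0; lra.
transitivity (\int[lebesgue_measure]_(x in `]a, b[) (inv_kernel a b x)%:E)%E.
  rewrite -(@integral_itv_bndoo R a b _ true false); last first.
    apply/measurable_EFinP; apply: measurable_funTS.
    exact: measurable_inv_kernel.
  rewrite [RHS]integral_mkcond; apply: eq_integral => x _.
  by rewrite patchE mem_setE in_itv/= /inv_kernel; case: ifP.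
transitivity (\int[lebesgue_measure]_(x in `]a, b[) (x^-1)%:E)%E.
  apply: eq_integral => x; rewrite inE/= in_itv/= /inv_kernel => /andP[ax xb].
  by rewrite !ltW.
rewrite Defs.integral_inv ?expR_gt0// !expRK; congr EFin; ring.
Qed.

Lemma cvg_gln_kernel x :
  gln_kernel mu sigma r x @[r --> +oo] --> inv_kernel a b x.
Proof.
rewrite /inv_kernel; have [x0|x0] := ltP 0 x; last first.
  rewrite leNgt (le_lt_trans x0) ?expR_gt0//=.
  by under eq_fun do rewrite /gln_kernel ltNge x0/=; exact: cvg_cst.
(* Taking logarithms, [a <= x <= b] means [|ln x - mu| <= sigma]. *)
have -> : (if a <= x <= b then x^-1 else 0) = x^-1 * ((`|ln x - mu| / sigma <= 1)%R%:R).
  rewrite ler_pdivrMr// mul1r ler_distl -{1 2}(@lnK _ x)// !ler_expR.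
  by case: ifP => _; rewrite ?mulr1 ?mulr0.
have u0 : 0 <= `|ln x - mu| / sigma by rewrite divr_ge0 ?(ltW sigma_gt0).
apply: cvg_trans (cvgM (cvg_cst _) (cvg_expRN_powR_div u0)).
apply: near_eq_cvg; near=> r; rewrite gln_kernelE//.
Unshelve. all: by end_near. Qed.

(* Young's inequality supplies a dominating function independent of [r]. *)
Lemma gln_kernel_le r x : 1 <= r ->
  gln_kernel mu sigma r x <= expR 1 * gln_kernel mu sigma 1 x.
Proof.
move=> r1; have [x0|x0] := ltP 0 x; last first.
  by rewrite /gln_kernel ltNge x0/= mulr0.
have r0 : 0 < r by exact: lt_le_trans r1.
rewrite !gln_kernelE// mulrCA ler_wpM2l ?invr_ge0 ?(ltW x0)// -expRD ler_expR.
have u0 : 0 <= `|ln x - mu| / sigma by rewrite divr_ge0 ?(ltW sigma_gt0).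
rewrite powRr1// divr1 lerNl opprD opprK addrC.
exact: subr1_le_powR_div.
Qed.

Lemma measurable_gln_kernelT r : measurable_fun [set: R] (gln_kernel mu sigma r).
Proof. exact: measurable_gln_kernel. Qed.

Lemma integrable_gln_kernel r : 0 < r ->
  lebesgue_measure.-integrable [set: R] (fun x => (gln_kernel mu sigma r x)%:E).
Proof.
move=> r0; apply/integrableP; split;
  first by apply/measurable_EFinP; exact: measurable_gln_kernelT.
under eq_integral do rewrite gee0_abs ?lee_fin ?gln_kernel_ge0//.
by rewrite integral_gln_kernel ?ltry// invr_gt0 mulr_gt0// powR_gt0.
Qed.

(** Dominated convergence also delivers integrability of the limit, which later allows constants to
    be pulled out of the integral and limits to be multiplied. *)
Lemma cvg_integral_gln_kernel (h : R -> R) (M : R) :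
  measurable_fun [set: R] h -> (forall x, `|h x| <= M) ->
  (\int[lebesgue_measure]_x (h x * gln_kernel mu sigma r x)%:E @[r --> +oo%R] -->
    \int[lebesgue_measure]_x (h x * inv_kernel a b x)%:E)%E /\
  lebesgue_measure.-integrable [set: R] (fun x => (h x * inv_kernel a b x)%:E).
Proof.
move=> mh hM.
(* Dominated convergence concerns sequences, so the limit in [r] is tested along sequences tending
   to infinity. *)
have dct (v : R^nat) : (forall n, 1 <= v n) -> v n @[n --> \oo] --> +oo ->
  (\int[lebesgue_measure]_x (h x * gln_kernel mu sigma (v n) x)%:E @[n --> \oo] -->
    \int[lebesgue_measure]_x (h x * inv_kernel a b x)%:E)%E /\
  lebesgue_measure.-integrable [set: R] (fun x => (h x * inv_kernel a b x)%:E).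
  move=> v1 voo.
  have [|||||] := @dominated_convergence _ _ R lebesgue_measure setT measurableT
    (fun n x => (h x * gln_kernel mu sigma (v n) x)%:E)
    (fun x => (h x * inv_kernel a b x)%:E)
    (fun x => ((M * expR 1)%:E * (gln_kernel mu sigma 1 x)%:E)%E) => //.
  - move=> n; apply/measurable_EFinP; apply: measurable_funM => //.
    exact: measurable_gln_kernelT.
  - by apply/measurable_EFinP; apply: measurable_funM => //;
      exact: measurable_inv_kernel.
  - apply: aeW => x _; apply: cvg_EFin; first exact: nearW.
    exact: (cvgM (cvg_cst (h x)) (cvg_comp _ _ voo (@cvg_gln_kernel x))).
  - by apply: integrableZl => //; exact: integrable_gln_kernel.
  - apply: aeW => x n _; rewrite -EFinM lee_fin normrM -mulrA.
    by rewrite ler_pM// ger0_norm ?gln_kernel_ge0// gln_kernel_le.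
split; last first.
  apply: (dct (fun n => n%:R + 1)%R _ _).2; first by move=> n; rewrite lerDr.
  apply/cvgryPge => A; near=> n; rewrite (@le_trans _ _ n%:R) ?lerDl//.
  by near: n; exact: nbhs_infty_ger.
apply/cvge_pinftyP => u uoo.
have uge A : \forall n \near \oo, A <= u n by move: A; exact/cvgryPge.
(* The domination requires exponents at least 1 at every index; truncating [u] from below at 1
   changes only finitely many terms. *)
apply: cvg_trans (dct (fun n => Num.max (u n) 1) _ _).1.
- apply: near_eq_cvg; near=> n; rewrite max_l//.
  by near: n; exact: uge.
- by move=> n; rewrite le_max lexx orbT.
- apply/cvgryPge => A; near=> n; rewrite le_max; apply/orP; left.
  by near: n; exact: uge.
Unshelve. all: by end_near. Qed.
End kernels.

(** * The log-uniform limit *)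

Section limit.
Context (R : realType) (mu sigma : R).
Hypothesis sigma_gt0 : 0 < sigma.
Let a := expR (mu - sigma).
Let b := expR (mu + sigma).

(** Total mass 1 identifies the normalizing constant with the inverse of the kernel's integral,
    which removes [Gamma] from the limit argument. *)
Lemma expectation_gln (h : R -> R) (M r : R) : 0 < r ->
  measurable_fun [set: R] h -> (forall x, `|h x| <= M) ->
  'E_(gln_prob mu sigma r : probability (measurableTypeR R) R)[h]%E =
  ((fine (\int[lebesgue_measure]_x (gln_kernel mu sigma r x)%:E))^-1%:E *
  \int[lebesgue_measure]_x (h x * gln_kernel mu sigma r x)%:E)%E.
Proof.
move=> r0 mh hM.
have mk := @measurable_gln_kernelT R mu sigma r.
have k0 x := @gln_kernel_ge0 R mu sigma r x.
have ik := integrable_gln_kernel mu sigma_gt0 r0.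
pose c := (2 * r `^ r^-1 * sigma * Gamma (1 + r^-1))^-1.
have pdfE x : gln_pdf mu sigma r x = c * gln_kernel mu sigma r x by rewrite gln_pdfE.
have -> : (fine (\int[lebesgue_measure]_x (gln_kernel mu sigma r x)%:E))^-1 = c.
  have : (c%:E * \int[lebesgue_measure]_x (gln_kernel mu sigma r x)%:E = 1)%E.
    rewrite -integralZl// -(integral_gln_pdf mu sigma r).
    by apply: eq_integral => x _; rewrite pdfE EFinM.
  rewrite -[X in (_ * X)%E]fineK ?integrable_fin_num// -EFinM => -[cJ].
  (* The product being 1 rules out a zero integral, whose inverse would be 0 by convention. *)
  by rewrite -[LHS]mul1r -cJ mulfK//; apply: contra_eq_neq cJ => ->;
    rewrite mulr0 eq_sym oner_neq0.
rewrite (@measurable_bounded_expectation_density R (gln_pdf mu sigma r) h M)//.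
- under eq_integral do rewrite pdfE mulrCA EFinM.
  rewrite integralZl//.
  apply: (@le_integrable _ (measurableTypeR R) R lebesgue_measure _ measurableT _
    (fun x => M%:E * (gln_kernel mu sigma r x)%:E)%E); last exact: integrableZl.
    by apply/measurable_EFinP; apply: measurable_funM.
  move=> x _; rewrite -EFinM lee_fin !normrM ler_wpM2r//.
  by rewrite (le_trans (hM x))// ler_norm.
- exact: measurable_gln_pdf.
- by move=> x; exact: gln_pdf_ge0.
Qed.

(** This is the density of [exp U] with [U] uniform on [[mu - sigma, mu + sigma]]. *)
Definition limit_pdf (x : R) := (2 * sigma)^-1 * inv_kernel a b x.

Lemma limit_pdf_ge0 x : 0 <= limit_pdf x.
Proof. by rewrite mulr_ge0 ?inv_kernel_ge0// invr_ge0 mulr_ge0// ltW. Qed.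

Lemma measurable_limit_pdf : measurable_fun [set: measurableTypeR R] limit_pdf.
Proof. by apply: measurable_funM => //; exact: measurable_inv_kernel. Qed.

Lemma integral_limit_pdf : (\int[lebesgue_measure]_x (limit_pdf x)%:E = 1)%E.
Proof.
under eq_integral do rewrite /limit_pdf EFinM.
rewrite ge0_integralZl_EFin//.
- by rewrite integral_inv_kernel// -EFinM mulVf// gt_eqF// mulr_gt0.
- by move=> x _; rewrite lee_fin inv_kernel_ge0.
- by apply/measurable_EFinP; exact: measurable_inv_kernel.
- by rewrite invr_ge0 mulr_ge0// ltW.
Qed.

Definition limit_prob : probability (measurableTypeR R) R :=
  density_prob (la := lebesgue_measure) measurable_limit_pdf limit_pdf_ge0
    integral_limit_pdf.

Lemma limit_probE (A : set (measurableTypeR R)) :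
  limit_prob A = (\int[lebesgue_measure]_(x in A) (limit_pdf x)%:E)%E.
Proof. by []. Qed.

Lemma limit_prob_itv : limit_prob `[a, b]%classic = 1%E.
Proof.
rewrite limit_probE -integral_limit_pdf [LHS]integral_mkcond.
apply: eq_integral => x _; rewrite patchE mem_setE in_itv/=.
by case: ifPn => // xab; rewrite /limit_pdf /inv_kernel (negbTE xab) mulr0.
Qed.

Lemma cvg_gln_prob : cvg_in_distribution
  (fun r : R => gln_prob mu sigma r : probability (measurableTypeR R) R)
  (pinfty_nbhs R) limit_prob.
Proof.
move=> h ch [M hM].
have mh : measurable_fun [set: R] h by exact: continuous_measurable_fun.
have [hk ihk] := cvg_integral_gln_kernel mu sigma_gt0 mh hM.
have k1 : (\int[lebesgue_measure]_x (gln_kernel mu sigma r x)%:E @[r --> +oo%R] -->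
    (2 * sigma)%:E)%E.
  have [] := @cvg_integral_gln_kernel R mu sigma sigma_gt0 (fun=> 1) 1
    (measurable_cst _) (fun=> ltac:(by rewrite normr1)).
  under eq_fun do under eq_integral do rewrite mul1r.
  by under eq_integral do rewrite mul1r; rewrite integral_inv_kernel.
have -> : 'E_limit_prob[h]%E =
    ((2 * sigma)^-1%:E * \int[lebesgue_measure]_x (h x * inv_kernel a b x)%:E)%E.
  rewrite (@measurable_bounded_expectation_density R limit_pdf h M)//.
  - under eq_integral do rewrite /limit_pdf mulrCA EFinM.
    by rewrite integralZl.
  - exact: measurable_limit_pdf.
  - exact: limit_pdf_ge0.
have kV : (fine (\int[lebesgue_measure]_x (gln_kernel mu sigma r x)%:E)%E)^-1%:E
    @[r --> +oo] --> ((2 * sigma)^-1)%:E.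
  apply: cvg_EFin; first exact: nearW.
  apply: cvgV; first by rewrite gt_eqF// mulr_gt0.
  exact: fine_cvg k1.
(* Both limits are finite, so their extended-real product is well defined and the limits
   multiply. *)
apply: cvg_trans (cvgeM _ kV hk); last by rewrite mule_def_fin// integrable_fin_num.
by apply: near_eq_cvg; near=> r; rewrite (@expectation_gln h M r).
Unshelve. all: by end_near. Qed.

End limit.

Theorem theorem3 (R : realType) (mu sigma : R) (sigma_gt0 : 0 < sigma) :
  exists P : probability (measurableTypeR R) R,
    [/\ cvg_in_distribution
          (fun r : R => gln_prob mu sigma r : probability (measurableTypeR R) R)
          (pinfty_nbhs R) P,
        (exists a b : R, P `[a, b]%classic = 1%E)
      & moment_determinate P].
Proof.
exists (limit_prob mu sigma_gt0); split.
- exact: cvg_gln_prob.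
- by exists (expR (mu - sigma)), (expR (mu + sigma)); exact: limit_prob_itv.
- exact: bounded_support_moment_determinate (limit_prob_itv mu sigma_gt0).
Qed.
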